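(* Let $d\ge 3$ and let $\mathcal{G}=(X,E)$ be a $d$-uniform totally $(r_1,\dots,r_{d-1})$-regular hypergraph on $n$ vertices with adjacency matrix $M$. Assume that $f$ is an eigenvector of $M$ corresponding to an eigenvalue $\theta$ such that $f(x)\in\{\alpha,\beta\}$ for all $x\in X$, where $\alpha\neq\beta$ and both values are attained. Then $f$ is a perfect $2$-coloring of $\mathcal{G}$.
   Context: A hypergraph $\mathcal{G}=(X,E)$ has finite vertex set $X$ and hyperedges $e\in E$ that are nonempty subsets of $X$; it is $d$-uniform if all hyperedges have exactly $d$ vertices. The degree $\deg(T)$ of a set $T\subseteq X$ is the number of hyperedges $e\in E$ with $T\subseteq e$. A $d$-uniform hypergraph is totally $(r_1,\dots,r_{d-1})$-regular, with $r_i\in\mathbb{N}$, if $\deg(T)=r_i$ for every $i\in\{1,\dots,d-1\}$ and every $T\subseteq X$ with $|T|=i$. The adjacency matrix $M$ of a $d$-uniform hypergraph is the $d$-dimensional array indexed by $X^d$ with entry $m_{x_1,\dots,x_d}=\frac{1}{(d-1)!}$ if $\{x_1,\dots,x_d\}$ is a hyperedge (with $x_1,\dots,x_d$ distinct) and $0$ otherwise. A function $f:X\to\mathbb{C}$, $f\not\equiv0$, is an eigenvector of $M$ with eigenvalue $\theta\in\mathbb{C}$ if for all $x\in X$: $\sum_{x_2,\dots,x_d\in X}m_{x,x_2,\dots,x_d}f(x_2)\cdots f(x_d)=\theta f(x)^{d-1}$. A $2$-coloring is a surjective function $f$ from $X$ onto a $2$-element set of colors. The color range of a hyperedge $e$ is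 the multiset $\{f(x):x\in e\}$. A coloring is perfect if for any two vertices $x,y$ of the same color, the multisets of color ranges of hyperedges incident to $x$ and of hyperedges incident to $y$ coincide. *)

(* Defs.v *)
From HB Require Import structures.
From mathcomp Require Import all_boot all_order all_algebra.
From mathcomp Require Import finmap multiset reals.
From mathcomp.real_closed Require Export complex.

Set Implicit Arguments.
Unset Strict Implicit.
Unset Printing Implicit Defensive.

Import GRing.Theory.
Local Open Scope ring_scope.
Local Open Scope fset_scope.
Local Open Scope mset_scope.

Record hypergraph (X : finType) := Hypergraph {
  hyperedges : {set {set X}};
  hyperedges_neq0 : set0 \notin hyperedges
}.

Section Hypergraphs.
Variables (X : finType) (G : hypergraph X).

Definition uniform (d : nat) : Prop :=
  forall e : {set X}, e \in hyperedges G -> #|e| = d.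

Definition degree (T : {set X}) : nat :=
  #|[set e in hyperedges G | T \subset e]|.

(* Only the values r 1, ..., r (d - 1) matter. *)
Definition totally_regular (d : nat) (r : nat -> nat) : Prop :=
  uniform d /\
  forall i : nat, (1 <= i <= d.-1)%N ->
  forall T : {set X}, #|T| = i -> degree T = r i.

(* A d-dimensional array indexed by X^d is a function on d-tuples. *)
Definition adjacency_matrix (C : fieldType) (d : nat) (t : d.-tuple X) : C :=
  if uniq t && ([set x in t] \in hyperedges G) then ((d.-1)`!%:R)^-1 else 0.

Section Colorings.
Variable K : choiceType.

Definition color_range (f : X -> K) (e : {set X}) : {mset K} :=
  seq_mset [seq f x | x <- enum e].

Definition incident_color_ranges (f : X -> K) (x : X) : {mset {mset K}} :=
  seq_mset [seq color_range f e | e : {set X} <- enum (hyperedges G) & x \in e].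

(* The set of colors is not part of the type K: a k-coloring is a map into K
   that is onto some k-element subset of K. *)
Definition coloring (k : nat) (f : X -> K) : Prop :=
  exists S : {fset K}, #|` S| = k /\ codom f =i S.

Definition perfect_coloring (k : nat) (f : X -> K) : Prop :=
  coloring k f /\
  forall x y : X, f x = f y ->
    incident_color_ranges f x = incident_color_ranges f y.

End Colorings.
End Hypergraphs.

(* The tuples t with first entry x are the (x, x_2, ..., x_d), and their
   tails are the (x_2, ..., x_d). *)
Definition eigenvector (X : finType) (C : fieldType) (d : nat)
    (M : d.-tuple X -> C) (theta : C) (f : X -> C) : Prop :=
  (exists x : X, f x != 0) /\
  forall x : X,
    \sum_(t : d.-tuple X | ohead t == Some x)
        M t * \prod_(y <- behead t) f y
    = theta * f x ^+ d.-1.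

(* Main.v *)
Require Import Defs.
From mathcomp Require Import all_boot all_order all_algebra.
From mathcomp Require Import reals.
From mathcomp Require Import finmap multiset.

(** For a vertex [x] and a hyperedge [e] through [x], let [k] be the number of
    vertices of [e :\ x] with value [beta].  Since [f] takes two values, [f x] and
    [k] determine the color range of [e], so it suffices to show that the multiset
    of these numbers [k], over the hyperedges through [x], depends only on [f x].

    A finite multiset of natural numbers bounded by [m = d - 1] is determined by
    its binomial moments, the sums of ['C(k, i)] over its members, for [i <= m]
    ([binomial_moments_inj]).  These moments come from two sources.
    - For [i < m], the [i]-th moment counts the pairs of a hyperedge [e] through
      [x] and an [i]-set [T] of [beta]-vertices in [e :\ x].  Summing over [T]
      first, regularity makes it the product of [r (i + 1)] by the number of
      [i]-sets of [beta]-vertices other than [x] ([sum_binomial_regular]), which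
      depends only on whether [f x] is [beta].
    - For [i = m], write the eigenvalue equation as a sum over hyperedges through
      [x] ([sum_adjacency_matrix]); each contributes [alpha ^ (m - k) * beta ^ k].
      Substituting [beta = alpha + (beta - alpha)] and expanding
      ([prod_two_valued]) turns [theta * f x ^ m] into the linear combination of
      the moments with coefficients [(beta - alpha) ^ i * alpha ^ (m - i)].  The
      last coefficient, [(beta - alpha) ^ m], is nonzero even if [alpha] or [beta]
      is [0], so the lower moments and [f x] determine the top one. *)

Set Implicit Arguments.
Unset Strict Implicit.
Unset Printing Implicit Defensive.

Import GRing.Theory Num.Theory.

Local Open Scope ring_scope.
Local Open Scope complex_scope.

(** * Binomial moments of multisets of natural numbers *)

Lemma sum_binomial_count (m : nat) (s : seq nat) (i : nat) :
  all (fun k => k <= m)%N s ->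
  (\sum_(k <- s) 'C(k, i) = \sum_(k < m.+1) count_mem (k : nat) s * 'C(k, i))%N.
Proof.
move=> /allP s_le.
transitivity (\sum_(k <- s) \sum_(j < m.+1 | j == k :> nat) 'C(j, i))%N.
  apply: eq_big_seq => k /s_le k_le.
  by rewrite (big_pred1 (Ordinal (k_le : (k < m.+1)%N))).
rewrite (exchange_big_dep predT) //=; apply: eq_bigr => j _.
rewrite -sum1_count big_distrl /=.
by apply: eq_big => [k|k _]; rewrite ?mul1n // eq_sym.
Qed.

(** The matrix of the ['C(j, i)] is unitriangular, so the multiplicities of the
    values [j] are recovered from the moments, starting with the largest. *)
Lemma binomial_moments_inj (m : nat) (s t : seq nat) :
  all (fun k => k <= m)%N s -> all (fun k => k <= m)%N t ->
  (forall i, (i <= m)%N ->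
     (\sum_(k <- s) 'C(k, i) = \sum_(k <- t) 'C(k, i))%N) ->
  perm_eq s t.
Proof.
move=> s_le t_le moments.
have count_gt u j : all (fun k => k <= m)%N u -> (m < j)%N -> count_mem j u = 0%N.
  move=> /allP u_le lt_mj; apply/count_memPn/negP => /u_le.
  by rewrite leqNgt lt_mj.
(* [c] bounds the distance of [j] from the top, so that the descending induction
   on [j] becomes an induction on [c]. *)
have count_eq : forall c j, (m < j + c)%N -> count_mem j s = count_mem j t.
  elim=> [|c IHc] j; first by rewrite addn0 => lt_mj; rewrite !count_gt.
  have [lt_mj _|le_jm lt_mjc] := ltnP m j; first by rewrite !count_gt.
  have := moments j le_jm; rewrite !(@sum_binomial_count m) //.
  have j_lt : (j < m.+1)%N by [].
  rewrite (bigD1 (Ordinal j_lt)) // [X in _ = X](bigD1 (Ordinal j_lt)) //= binn !muln1.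
  suff ->: (\sum_(k < m.+1 | k != Ordinal j_lt) count_mem (k : nat) s * 'C(k, j)
          = \sum_(k < m.+1 | k != Ordinal j_lt) count_mem (k : nat) t * 'C(k, j))%N.
    exact: addIn.
  apply: eq_bigr => k; rewrite -val_eqE /= neq_ltn => /orP[lt_kj|lt_jk].
    by rewrite bin_small ?muln0.
  rewrite IHc //; apply: leq_trans lt_mjc _.
  by rewrite addnS -addSn leq_add2r.
by apply/allP => j _ /=; rewrite (count_eq m.+1 j) // addnS ltnS leq_addl.
Qed.

(** * Color ranges for two colors *)

Lemma perm_two_valued (K : eqType) (a b : K) (s : seq K) :
  all (fun c => (c == a) || (c == b)) s ->
  perm_eq s (nseq (count_mem b s) b ++ nseq (size s - count_mem b s) a).
Proof.
move=> /allP s_ab; rewrite -(perm_filterC (pred1 b) s).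
have /all_pred1P -> := filter_all (pred1 b) s; rewrite size_filter.
rewrite perm_cat2l -(count_predC (pred1 b) s) addKn -size_filter.
suff /all_pred1P {1}-> : all (pred1 a) (filter (predC (pred1 b)) s) by [].
apply/allP => c; rewrite mem_filter /= => /andP[ncb /s_ab].
by rewrite (negbTE ncb) orbF.
Qed.

(** The explicit right-hand side makes a color range a function of [f x] and [k]
    once the size of the hyperedge is known. *)
Lemma color_range_two_valued (X : finType) (K : choiceType) (a b : K)
    (f : X -> K) (x : X) (e : {set X}) :
  (forall z, f z = a \/ f z = b) -> x \in e ->
  let k := #|(e :\ x) :&: [set z | f z == b]| in
  color_range f e = seq_mset (f x :: nseq k b ++ nseq (#|e :\ x| - k) a).
Proof.
move=> f_ab xe k; apply/eq_seq_msetP.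
have /(perm_map f)/permPl -> : perm_eq (enum e) (x :: enum (e :\ x)).
  apply: uniq_perm; rewrite /= ?enum_uniq ?mem_enum ?setD11 //.
  by move=> z; rewrite inE !mem_enum !inE; case: eqVneq => // ->.
have f_all : all (fun c => (c == a) || (c == b)) [seq f z | z <- enum (e :\ x)].
  by apply/allP => _ /mapP[z _ ->]; case: (f_ab z) => ->; rewrite eqxx ?orbT.
rewrite /= perm_cons (permPl (perm_two_valued f_all)) size_map -cardE.
suff -> : count_mem b [seq f z | z <- enum (e :\ x)] = k by [].
rewrite count_map -size_filter /k cardE; apply/perm_size/uniq_perm.
- exact: filter_uniq (enum_uniq _).
- exact: enum_uniq.
- by move=> z; rewrite mem_filter !mem_enum !inE andbC.
Qed.

(** * Low moments from regularity *)

(** Double counting of the pairs of a hyperedge [e] through [x] and an [i]-subset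
    [T] of [(e :\ x) :&: B]: the hyperedges that go with [T] are those containing
    the set [x |: T], of size [i + 1]. *)
Lemma sum_binomial_regular (X : finType) (G : hypergraph X) (d : nat)
    (r : nat -> nat) (B : {set X}) (x : X) (i : nat) :
  totally_regular G d r -> (i < d.-1)%N ->
  (\sum_(e in hyperedges G | x \in e) 'C(#|(e :\ x) :&: B|, i)
   = 'C(#|B :\ x|, i) * r i.+1)%N.
Proof.
move=> [_ reg] lt_id.
transitivity (\sum_(e in hyperedges G | x \in e)
    \sum_(T : {set X} | (T \subset B :\ x) && (#|T| == i)) (T \subset e))%N.
  apply: eq_bigr => e _; rewrite -cards_draws -sum1dep_card [RHS]big_mkcond.
  rewrite [LHS]big_mkcond; apply: eq_bigr => T _.
  rewrite setIDAC -setIDA subsetI.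
  by case: (T \subset e); case: (T \subset B :\ x); case: (#|T| == i).
rewrite exchange_big /=.
have deg (T : {set X}) : (T \subset B :\ x) && (#|T| == i) ->
    (\sum_(e in hyperedges G | x \in e) (T \subset e) = r i.+1)%N.
  case/andP => TBx /eqP cardT; have xT : x \notin T.
    by apply/negP => /(subsetP TBx); rewrite !inE eqxx.
  rewrite -(reg i.+1 _ (x |: T)) ?cardsU1 ?xT ?cardT //.
  rewrite /degree -sum1dep_card big_mkcond [RHS]big_mkcond.
  apply: eq_bigr => e _; rewrite subUset sub1set.
  by case: (e \in _); case: (x \in e); case: (T \subset e).
by rewrite (eq_bigr _ deg) sum_nat_const -cards_draws cardsE.
Qed.

(** * The eigenvalue equation as a sum over hyperedges *)

Lemma card_tuples_with_head (X : finType) (m : nat) (x : X) (e : {set X}) :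
  #|e| = m.+1 -> x \in e ->
  #|[set t : m.+1.-tuple X |
      [&& ohead t == Some x, uniq t & [set z in t] == e]]| = m`!.
Proof.
move=> card_e xe.
have card_ex : #|e :\ x| = m by move: card_e; rewrite (cardsD1 x) xe => -[].
rewrite -[RHS]ffactnn -[X in _ = X ^_ _]card_ex -card_uniq_tuples.
rewrite -(card_imset (f := fun s : m.-tuple X => [tuple of x :: s])); last first.
  by move=> s1 s2 [] /val_inj.
apply: eq_card => t; rewrite !inE; apply/idP/imsetP => [|[s]].
  case/tupleP: t => y s /= /and3P[/eqP[->] /andP[xs us] /eqP def_e].
  exists s; rewrite ?inE ?us ?andbT //.
  apply/allP => z zs; change (z \in e :\ x); rewrite -def_e !inE zs orbT andbT.
  by apply: contraNneq xs => <-.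
rewrite inE => /andP[/allP s_e us] ->; rewrite /= eqxx us andbT /=.
have xs : x \notin s by apply/negP => /s_e /setD1P[]; rewrite eqxx.
rewrite xs eqEcard card_e; rewrite andTb; apply/andP; split.
  by apply/subsetP => z; rewrite !inE => /predU1P[->|/s_e /setD1P[]].
by rewrite cardsE (card_uniqP _) /= ?size_tuple // xs.
Qed.

(** Each hyperedge through [x] is listed by [m`!] tuples starting at [x], which
    the entry [1 / m`!] of the adjacency matrix compensates. *)
Lemma sum_adjacency_matrix (X : finType) (G : hypergraph X)
    (C : numFieldType) (m : nat) (f : X -> C) (x : X) :
  uniform G m.+1 ->
  \sum_(t : m.+1.-tuple X | ohead t == Some x)
     adjacency_matrix G C t * \prod_(y <- behead t) f y
  = \sum_(e in hyperedges G | x \in e) \prod_(y in e :\ x) f y.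
Proof.
move=> unif.
transitivity (\sum_(t : m.+1.-tuple X | (ohead t == Some x) &&
                (uniq t && ([set z in t] \in hyperedges G)))
    (m`!%:R)^-1 * \prod_(y in [set z in t] :\ x) f y).
  rewrite [RHS]big_mkcondr; apply: eq_bigr => t /eqP ht.
  rewrite /adjacency_matrix; case: ifP => [/andP[ut _]|_]; last by rewrite mul0r.
  congr (_ * _); case/tupleP: t ht ut => y s /= [->] /andP[xs us].
  rewrite big_uniq //; apply: eq_bigl => z; rewrite !inE.
  by have [->|] := eqVneq z x; rewrite ?(negbTE xs).
rewrite (partition_big (fun t : m.+1.-tuple X => [set z in t])
   (fun e => (e \in hyperedges G) && (x \in e))) /=; last first.
  move=> t /and3P[/eqP ht _ ->] /=; rewrite inE.
  by case/tupleP: t ht => y s /= [->]; rewrite inE eqxx.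
apply: eq_bigr => e /andP[eG xe].
rewrite (eq_bigr (fun=> (m`!%:R)^-1 * \prod_(y in e :\ x) f y)); last first.
  by move=> t /andP[_ /eqP->].
rewrite sumr_const (_ : #|_| = m`!); last first.
  rewrite -(card_tuples_with_head (unif e eG) xe) cardsE; apply: eq_card => t.
  rewrite !unfold_in /=; case: eqP => //= _; case: (uniq t) => //=.
  by case: eqP => [->|_]; [rewrite andbT; exact: eG | rewrite andbF].
by rewrite -[LHS]mulr_natl mulrA mulfV ?mul1r // pnatr_eq0 -lt0n fact_gt0.
Qed.

(** Expanding [b ^ k] in powers of [b - a] replaces the number [k] of factors
    equal to [b] by the binomial coefficients ['C(k, i)]; these vanish for [k < i],
    so the sum can have a length that does not depend on [k]. *)
Lemma prod_two_valued (X : finType) (C : comNzRingType) (a b : C) (f : X -> C)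
    (A : {set X}) :
  (forall z, f z = a \/ f z = b) ->
  \prod_(y in A) f y
  = \sum_(i < #|A|.+1)
      (b - a) ^+ i * a ^+ (#|A| - i) *+ 'C(#|A :&: [set z | f z == b]|, i).
Proof.
move=> f_ab; set B := [set z | f z == b]; set k := #|A :&: B|.
have le_kA : (k <= #|A|)%N by rewrite subset_leq_card ?subsetIl.
rewrite (big_setID B) /= (eq_bigr (fun=> b)); last first.
  by move=> y; rewrite !inE => /andP[_ /eqP].
rewrite [X in _ * X](eq_bigr (fun=> a)); last first.
  by move=> y; rewrite !inE => /andP[nb _]; case: (f_ab y) nb => -> //; rewrite eqxx.
rewrite !prodr_const cardsD -/k -{1}[b](subrK a) addrC exprDn.
rewrite -(big_mkord xpredT
  (fun i => (b - a) ^+ i * a ^+ (#|A| - i) *+ 'C(k, i))).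
rewrite (big_cat_nat (n := k.+1)) //= [X in _ = _ + X]big1_seq ?addr0; last first.
  by move=> i; rewrite mem_index_iota => /andP[_ /andP[lt_ki _]]; rewrite bin_small ?mulr0n.
rewrite big_mkord mulr_suml; apply: eq_bigr => i _.
have le_ik : (i <= k)%N by rewrite -ltnS.
rewrite mulrnAl mulrAC -exprD mulrC; congr (_ * _ ^+ _ *+ _).
by rewrite addnC addnBA // subnK.
Qed.

(** * Two-valued eigenvectors *)

Theorem theorem4 (R : realType) (X : finType) (G : hypergraph X)
    (n d : nat) (r : nat -> nat)
    (f : X -> R[i]) (theta alpha beta : R[i]) :
  (3 <= d)%N ->
  #|X| = n ->
  totally_regular G d r ->
  eigenvector (@adjacency_matrix X G R[i] d) theta f ->
  alpha != beta ->
  (forall x : X, f x = alpha \/ f x = beta) ->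
  (exists x : X, f x = alpha) ->
  (exists x : X, f x = beta) ->
  perfect_coloring G 2 f.
Proof.
case: d => [//|m] _ _ reg [_ eigen] neq_ab f_ab [xa f_xa] [xb f_xb].
split.
  exists [fset alpha; beta]%fset; split; first by rewrite cardfs2 neq_ab.
  move=> c; rewrite !inE; apply/codomP/orP => [[z ->]|[/eqP->|/eqP->]].
  - by case: (f_ab z) => ->; rewrite eqxx; [left|right].
  - by exists xa.
  - by exists xb.
move=> x y fxy; have [unif _] := reg.
pose B := [set z | f z == beta].
pose b_count z (e : {set X}) := #|(e :\ z) :&: B|.
pose edges z := [seq e : {set X} <- enum (hyperedges G) | z \in e].
have edgesP z e : e \in edges z -> [/\ z \in e, #|e| = m.+1 & #|e :\ z| = m].
  rewrite mem_filter mem_enum => /andP[ze eG]; have card_e := unif e eG.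
  by split=> //; move: card_e; rewrite (cardsD1 z) ze => -[].
have b_count_le z : all (fun k => k <= m)%N [seq b_count z e | e <- edges z].
  apply/allP => _ /mapP[e /edgesP[_ _ <-] ->].
  by rewrite subset_leq_card ?subsetIl.
have big_edges (T : Type) (idx : T) (op : Monoid.com_law idx) z (F : {set X} -> T) :
    \big[op/idx]_(e in hyperedges G | z \in e) F e = \big[op/idx]_(e <- edges z) F e.
  by rewrite big_filter big_enum_cond.
have low_moments i : (i < m)%N ->
    (\sum_(k <- [seq b_count x e | e <- edges x]) 'C(k, i)
     = \sum_(k <- [seq b_count y e | e <- edges y]) 'C(k, i))%N.
  move=> lt_im; rewrite !big_map -!big_edges.
  rewrite !(sum_binomial_regular _ _ reg) //.
  congr ('C(_, _) * _)%N.
  have := cardsD1 x B; rewrite (cardsD1 y B) !inE fxy => /eqP.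
  by rewrite eqn_add2l => /eqP.
have eigen_moments z : theta * f z ^+ m
    = \sum_(i < m.+1) (beta - alpha) ^+ i * alpha ^+ (m - i)
        *+ (\sum_(k <- [seq b_count z e | e <- edges z]) 'C(k, i)).
  rewrite -(eigen z) sum_adjacency_matrix // big_edges.
  under [RHS]eq_bigr do rewrite big_map -sumrMnr.
  rewrite exchange_big /=; apply: eq_big_seq => e /edgesP[_ _ card_ez].
  by rewrite (prod_two_valued _ f_ab) card_ez.
have top_moment :
    (\sum_(k <- [seq b_count x e | e <- edges x]) 'C(k, m)
     = \sum_(k <- [seq b_count y e | e <- edges y]) 'C(k, m))%N.
  have := eigen_moments x; rewrite fxy eigen_moments !big_ord_recr /=.
  under eq_bigr => i _ do rewrite -low_moments //.
  (* The terms of index below [m] cancel, which leaves [(beta - alpha) ^+ m] times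
     the difference of the two top moments. *)
  move=> /addrI /eqP; rewrite subnn expr0 mulr1 eq_sym.
  rewrite -subr_eq0 -!(mulr_natr ((beta - alpha) ^+ m)) -mulrBr mulf_eq0.
  rewrite expf_eq0 subr_eq0 [beta == _]eq_sym (negbTE neq_ab) andbF /=.
  by rewrite subr_eq0 eqr_nat => /eqP.
have perm_counts :
    perm_eq [seq b_count x e | e <- edges x] [seq b_count y e | e <- edges y].
  apply: (@binomial_moments_inj m) => // i; rewrite leq_eqVlt.
  by case/predU1P => [->|/low_moments].
apply/eq_seq_msetP.
pose range_of (k : nat) := seq_mset (f x :: nseq k beta ++ nseq (m - k) alpha).
have ranges z : f z = f x ->
    [seq color_range f e | e <- edges z]
    = [seq range_of k | k <- [seq b_count z e | e <- edges z]].
  move=> fzx; rewrite -map_comp; apply/eq_in_map => e /edgesP[ze _ card_ez].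
  by rewrite (color_range_two_valued f_ab ze) /= card_ez fzx.
by rewrite ranges // ranges //; apply: perm_map.
Qed.
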